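(* Let $F$ be a number field Galois over $\mathbb Q$, $M$ an even integer divisible by the discriminant of $F$, $\mathcal O=\mathcal O_F[1/M]$, $p$ a prime not dividing $M$, $\mathfrak P$ a prime of $\mathcal O$ above $p$, with Frobenius element $\phi_p\in\mathrm{Gal}(F/\mathbb Q)$. Let $\sigma_1=\mathrm{id},\sigma_2\in\mathrm{Gal}(F/\mathbb Q)$ be a vertical gauge, and let $d\in\mathcal O^\times$ be vertical gauge invariant, i.e. $\sigma_2(d)=d$. Let $E'=F(\alpha,\beta)$ with $\alpha,\beta$ indeterminates, and let $E'''=F(t)\subset E'$, $t=\alpha/\beta$. For $i=1,2$ let $\Gamma'_{pi}$ be the correspondence on $\mathrm{Spec}\,E'$ attached to $d$ (see context). Then there exist categorically reduced correspondences $\Gamma'''_{pi}$ in $\mathcal C_0(E''')$, $$\mathrm{Spec}\,E'''\xleftarrow{\ \pi'''_p\ }Y'''_{p/E'''}\xrightarrow{\ \varphi'''_{pi}\ }\mathrm{Spec}\,E''',\qquad i=1,2,$$ equipped with morphisms from $\Gamma'_{pi}$ to $\Gamma'''_{pi}$ extending the inclusion $E'''\subset E'$. Moreover, up to isomorphisms in $\mathcal C_0(E''')$, the categorically reduced correspondences $\Gamma'''_{pi}$ and the morphisms from $\Gamma'_{pi}$ to $\Gamma'''_{pi}$ are unique.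
   Context: Correspondences. A correspondence on a scheme $X$ is a diagram $\Gamma=(Y,\pi,\varphi)$: $X\xleftarrow{\pi}Y\xrightarrow{\varphi}X$ of schemes. A morphism $(Y',\pi',\varphi')\to(Y,\pi,\varphi)$ of correspondences on $X$ is a morphism $v:Y'\to Y$ with $\pi'=\pi\circ v$, $\varphi'=\varphi\circ v$. Given a morphism $u:X'\to X$, a correspondence $\Gamma'=(Y',\pi',\varphi')$ on $X'$ and a correspondence $\Gamma=(Y,\pi,\varphi)$ on $X$, a morphism from $\Gamma'$ to $\Gamma$ extending $u$ is a morphism of correspondences on $X$ from $(Y',u\circ\pi',u\circ\varphi')$ to $\Gamma$, i.e. a morphism of schemes $v:Y'\to Y$ with $\pi\circ v=u\circ\pi'$, $\varphi\circ v=u\circ\varphi'$. Here $u:\mathrm{Spec}\,E'\to\mathrm{Spec}\,E'''$ is the morphism induced by the inclusion $E'''\subset E'$. For a field $E$ of characteristic $0$, $\mathcal C_0(E)$ is the category whose objects are correspondences $(Y,\pi,\varphi)$ on $\mathrm{Spec}\,E$ such that $Y$ is the spectrum of a finite product of fields that are finite extensions of $E$ via $\pi$ (so $\pi$ is étale) and $\varphi$ is finite, and whose morphisms are the morphisms of correspondences $v$ which are surjective. A correspondence $\Gamma$ in $\mathcal C_0(E)$ (not necessarily with $Y$ irreducible) is categorically reduced if every morphism $\Gamma\to\Gamma'$ in $\mathcal C_0(E)$ is an isomorphism. If $Y=\mathrm{Spec}\,L$ with $L$ a field, this means that $L$ is the compositum of $\pi(E)$ and $\varphi(E)$; in general it means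 that all the irreducible components of $\Gamma$ (the correspondences defined by the connected components of $Y$) are categorically reduced and no two of them are isomorphic in $\mathcal C_0(E)$. The correspondences $\Gamma'_{pi}$ (the generic-point version of the algebraization of the arithmetic Levi-Civita connection attached to $q=d\cdot 1_2$) are explicitly the following. Let $$\theta_p=\frac{d^p(\alpha^2+\beta^2)^p}{\phi_p(d)(\alpha^{2p}+\beta^{2p})}\in E'.$$ Let $L'_p=E'(v_p)$ be the field generated over $E'$ by a root $v_p$ of the (irreducible) polynomial $2z^2+2z+1-\theta_p$, and $u_p=1+v_p$. Then $\Gamma'_{pi}=(\mathrm{Spec}\,L'_p,\pi'_p,\varphi'_{pi})$ where $\pi'_p$ corresponds to the inclusion $E'\subset L'_p$ and $\varphi'_{p1},\varphi'_{p2}$ correspond to the field homomorphisms $E'\to L'_p$ acting on $F$ via $\phi_p$ and given on $\alpha,\beta$ by $$\varphi'_{p1}\begin{pmatrix}\alpha&\beta\\ -\beta&\alpha\end{pmatrix}=\begin{pmatrix}\alpha^p&\beta^p\\ -\beta^p&\alpha^p\end{pmatrix}\begin{pmatrix}u_p&v_p\\ -v_p&u_p\end{pmatrix},\quad \varphi'_{p2}\begin{pmatrix}\alpha&\beta\\ -\beta&\alpha\end{pmatrix}=\begin{pmatrix}\alpha^p&\beta^p\\ -\beta^p&\alpha^p\end{pmatrix}\begin{pmatrix}u_p&-v_p\\ v_p&u_p\end{pmatrix}.$$ (Homomorphisms are applied to matrices entrywise.)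
   Formalization: Morphisms from Γ'_{pi} to Γ'''_{pi} are required to be surjective, as in C_0; otherwise uniqueness fails, since adding a non-isomorphic reduced component such as (Spec E''', id, id) to Γ'''_{pi} keeps it categorically reduced and still gives a morphism. *)

(* Defs.v *)
From HB Require Import structures.
From mathcomp Require Import all_boot all_order all_algebra.
From mathcomp Require Import all_fingroup all_solvable all_field.
From mathcomp Require Import mpoly.

Set Implicit Arguments.
Unset Strict Implicit.
Unset Printing Implicit Defensive.

Import GRing.Theory.
Local Open Scope ring_scope.

(* All schemes here are affine, and are represented by their rings of         *)
(* functions: a morphism Spec A -> Spec B is a ring morphism B -> A.          *)

(* S is meant to be a subring of R, and P a subset of S. *)
Definition prime_ideal_of (R : comPzRingType) (S P : R -> Prop) : Prop :=
  [/\ forall x, P x -> S x,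
      P 0,
      forall x y, P x -> P y -> P (x + y) &
      forall x y, S x -> P y -> P (x * y)] /\
  (~ P 1 /\ forall x y, S x -> S y -> P (x * y) -> P x \/ P y).

Definition prime_ideal (R : comPzRingType) (P : R -> Prop) : Prop :=
  prime_ideal_of (fun=> True) P.

(* The morphism of schemes Spec B -> Spec A induced by f is surjective. *)
Definition spec_surjective (A B : comPzRingType) (f : {rmorphism A -> B}) :
    Prop :=
  forall P : A -> Prop, prime_ideal P ->
  exists2 Q : B -> Prop, prime_ideal Q & forall x, P x <-> Q (f x).

(* B is a finitely generated module over A via f. *)
Definition finite_rmorphism (A B : comPzRingType) (f : {rmorphism A -> B}) :
    Prop :=
  exists (n : nat) (e : 'I_n -> B),
  forall b : B, exists c : 'I_n -> A, b = \sum_i f (c i) * e i.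

(* The correspondence Spec E <-pi- Spec Y -phi-> Spec E. *)
Record correspondence (E : comPzRingType) : Type := Correspondence {
  corr_ring : comPzRingType;
  corr_pi : {rmorphism E -> corr_ring};
  corr_phi : {rmorphism E -> corr_ring} }.

(* v is a morphism of correspondences G' -> G on Spec E. *)
Definition corr_mor (E : comPzRingType) (G' G : correspondence E)
    (v : {rmorphism corr_ring G -> corr_ring G'}) : Prop :=
  (forall x, v (corr_pi G x) = corr_pi G' x) /\
  (forall x, v (corr_phi G x) = corr_phi G' x).

(* (Y', u o pi', u o phi') for u : Spec E' -> Spec E. *)
Definition corr_push (E E' : comPzRingType) (u : {rmorphism E -> E'})
    (G' : correspondence E') : correspondence E :=
  @Correspondence E (corr_ring G')
    (corr_pi G' \o u : {rmorphism E -> corr_ring G'})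
    (corr_phi G' \o u : {rmorphism E -> corr_ring G'}).

(* v is a morphism G' -> G extending u : Spec E' -> Spec E. *)
Definition corr_mor_ext (E E' : comPzRingType) (u : {rmorphism E -> E'})
    (G' : correspondence E') (G : correspondence E)
    (v : {rmorphism corr_ring G -> corr_ring G'}) : Prop :=
  @corr_mor E (corr_push u G') G v.

(* Objects of C_0(E). The ring of G is a product of the fields K i, with      *)
(* projections h i; n = 0 is allowed.                                         *)
Definition in_C0 (E : fieldType) (G : correspondence E) : Prop :=
  (exists (n : nat) (K : 'I_n -> fieldType)
          (h : forall i, {rmorphism corr_ring G -> K i}),
     (forall k : (forall i, K i), exists! a, forall i, h i a = k i) /\
     (forall i, finite_rmorphism (h i \o corr_pi G : {rmorphism E -> K i}))) /\
  finite_rmorphism (corr_phi G).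

Definition C0_mor (E : fieldType) (G' G : correspondence E)
    (v : {rmorphism corr_ring G -> corr_ring G'}) : Prop :=
  corr_mor v /\ spec_surjective v.

Definition C0_iso (E : fieldType) (G' G : correspondence E)
    (v : {rmorphism corr_ring G -> corr_ring G'}) : Prop :=
  C0_mor v /\
  exists w : {rmorphism corr_ring G' -> corr_ring G},
    [/\ @C0_mor E G G' w, cancel v w & cancel w v].

Definition categorically_reduced (E : fieldType) (G : correspondence E) :
    Prop :=
  in_C0 G /\
  forall (G' : correspondence E)
         (v : {rmorphism corr_ring G' -> corr_ring G}),
    in_C0 G' -> @C0_mor E G G' v -> @C0_iso E G G' v.

(* G is a categorically reduced correspondence on Spec E, and v is a morphism *)
(* G' -> G extending u. As for the morphisms of C_0, v is required to be      *)
(* surjective; otherwise G could have components not met by G', and would     *)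
(* not be determined by G'.                                                   *)
Definition reduction (E E' : fieldType) (u : {rmorphism E -> E'})
    (G' : correspondence E') (G : correspondence E)
    (v : {rmorphism corr_ring G -> corr_ring G'}) : Prop :=
  [/\ categorically_reduced G, corr_mor_ext u v & spec_surjective v].

Section NumberField.
Variable F : splittingFieldType rat.

Definition integral (x : F) : Prop := integralOver (intr : int -> F) x.

Definition integral_basis (n : nat) (b : 'I_n -> F) : Prop :=
  (forall i, integral (b i)) /\
  forall x, integral x ->
    exists! c : {ffun 'I_n -> int}, x = \sum_i b i *~ c i.

(* For F Galois over Q, galTrace 1 {:F} is the trace of F over Q. *)
Definition is_discriminant (D : int) : Prop :=
  exists (n : nat) (b : 'I_n -> F), integral_basis b /\
    D%:~R = \det (\matrix_(i < n, j < n) galTrace 1%AS {:F}%AS (b i * b j)).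

Definition localized_integers (M : int) (x : F) : Prop :=
  exists n : nat, integral (M%:~R ^+ n * x).

Definition localized_units (M : int) (x : F) : Prop :=
  [/\ x != 0, localized_integers M x & localized_integers M x^-1].

Definition prime_lying_above (M : int) (p : nat) (P : F -> Prop) : Prop :=
  prime_ideal_of (localized_integers M) P /\ P p%:R.

(* These congruences imply phi P = P. *)
Definition is_frobenius (M : int) (p : nat) (P : F -> Prop)
    (phi : gal_of {:F}%AS) : Prop :=
  phi \in 'Gal({:F} / 1)%g /\
  forall x, localized_integers M x -> P (phi x - x ^+ p).

(* Fab = F(alpha, beta), and Ft = F(t) = F('X). *)
Definition Fab : fieldType := {fraction {mpoly F[2]}}.
Definition Ft : fieldType := {fraction {poly F}}.

Definition Fab_const (c : F) : Fab := FracField.tofrac (c%:MP : {mpoly F[2]}).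
Definition Ft_const (c : F) : Ft := FracField.tofrac (c%:P).

Definition alpha : Fab := FracField.tofrac ('X_(0 : 'I_2) : {mpoly F[2]}).
Definition beta : Fab := FracField.tofrac ('X_(1 : 'I_2) : {mpoly F[2]}).

(* u is the inclusion of F(t) in F(alpha, beta), with t = alpha / beta. *)
Definition Ft_inclusion (u : {rmorphism Ft -> Fab}) : Prop :=
  (forall c : F, u (Ft_const c) = Fab_const c) /\
  u (FracField.tofrac 'X) = alpha / beta.

Definition theta (p : nat) (phi : gal_of {:F}%AS) (d : F) : Fab :=
  (Fab_const d ^+ p * (alpha ^+ 2 + beta ^+ 2) ^+ p) /
  (Fab_const (phi d) * (alpha ^+ (2 * p) + beta ^+ (2 * p))).

Definition theta_poly (p : nat) (phi : gal_of {:F}%AS) (d : F) : {poly Fab} :=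
  2%:P * 'X^2 + 2%:P * 'X + 1 - (theta p phi d)%:P.

(* L = F(alpha, beta)(v), with v a root of 2 z^2 + 2 z + 1 - theta. *)
Definition theta_extension (p : nat) (phi : gal_of {:F}%AS) (d : F)
    (L : fieldExtType Fab) (v : L) : Prop :=
  root (map_poly (in_alg L) (theta_poly p phi d)) v /\
  <<1; v>>%VS = fullv :> {vspace L}.

Definition rotation_mx (K : nzRingType) (a b : K) : 'M[K]_2 :=
  \matrix_(i < 2, j < 2)
    if i == j then a else if i == 0 then b else - b.

Definition gauged_frobenius (p : nat) (phi : gal_of {:F}%AS)
    (L : fieldExtType Fab) (R : 'M[L]_2) (f : {rmorphism Fab -> L}) : Prop :=
  (forall c : F, f (Fab_const c) = in_alg L (Fab_const (phi c))) /\
  map_mx f (rotation_mx alpha beta) =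
    map_mx (in_alg L) (rotation_mx (alpha ^+ p) (beta ^+ p)) *m R.

End NumberField.

(* Main.v *)
Require Import Defs.
From HB Require Import structures.
From mathcomp Require Import all_boot all_order all_algebra.
From mathcomp Require Import all_fingroup all_solvable all_field.
From mathcomp Require Import mpoly ring.

Set Implicit Arguments.
Unset Strict Implicit.
Unset Printing Implicit Defensive.

Import GRing.Theory.
Local Open Scope ring_scope.

(* Write t for alpha / beta in L and s_i for f_i(t). The defining relations   *)
(* give v = (t^p - s) / (e s t^p + s - t^p + e) with e = 1, -1 for i = 1, 2,  *)
(* so that the compositum of F(t) and f_i(F(t)) is Y = F(t)(v) for both i.    *)
(* Y has degree at most 2 over F(t), and is finite over f_i(F(t)) since       *)
(* substituting v in 2 v^2 + 2 v + 1 = theta gives the polynomial equation    *)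
(* phi(d) (s^2 + 1) (t^(2p) + 1)^2 =                                          *)
(*   d^p (t^2 + 1)^p ((e s - 1) t^p + s + e)^2                                *)
(* for t over F(s). Conversely, the ring of any categorically reduced         *)
(* correspondence receiving Spec L surjectively is a field embedded in L that *)
(* contains F(t) and f_i(F(t)), hence Y; reducedness makes it equal to Y.     *)

(** Since [theta] is homogeneous of degree 0 in alpha and beta, it lies in F(t); so v is algebraic
    over F(t), and the single field Y = F(t)(v) serves both correspondences ([quadratic_root_eq],
    [quadratic_adjoin]). Dividing f_i(alpha) by f_i(beta) expresses s as a fractional linear
    function of v over F(t). Hence f_i maps F(t) into Y, and inverting this function puts v in the
    compositum ([twist_root]). Finiteness over f_i(F(t)) holds because the elimination polynomial
    [twist_poly] is nonzero and has t as a root ([twist_poly_neq0], [twist_poly_root]). The rest is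
    formal. A field which is the compositum of its two images is categorically reduced
    ([compositum_categorically_reduced]). Any other reduction is a field inside L containing this
    compositum, and its own reducedness identifies it with Y compatibly with the maps to L
    ([reduction_unique]). *)

Section Factorization.
Variables (A B C : comPzRingType).
Variables (w : {rmorphism A -> C}) (r : {rmorphism B -> C}).
Hypothesis w_inj : injective w.
Hypothesis r_im : forall b, exists a, w a == r b.

Let factor b : A := xchoose (r_im b).

Let factorK b : w (factor b) = r b.
Proof. exact/eqP/(xchooseP (r_im b)). Qed.

Fact factor_is_zmod_morphism : zmod_morphism factor.
Proof. by move=> x y; apply: w_inj; rewrite rmorphB !factorK rmorphB. Qed.

Fact factor_is_monoid_morphism : monoid_morphism factor.
Proof.
split=> [|x y]; apply: w_inj; first by rewrite factorK !rmorph1.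
by rewrite rmorphM !factorK rmorphM.
Qed.

HB.instance Definition _ := GRing.isZmodMorphism.Build B A factor
  factor_is_zmod_morphism.
HB.instance Definition _ := GRing.isMonoidMorphism.Build B A factor
  factor_is_monoid_morphism.

Lemma rmorph_factor : exists f : {rmorphism B -> A}, forall b, w (f b) = r b.
Proof. by exists factor. Qed.

End Factorization.

(** * Commutative rings that are fields, and their spectra *)

(** A property rather than a [fieldType], because the ring of a correspondence is only given as a
    commutative ring. *)
Definition field_like (A : comPzRingType) : Prop :=
  1 <> 0 :> A /\ forall x : A, x <> 0 -> exists y, x * y = 1.

Lemma field_field_like (K : fieldType) : field_like K.
Proof.
split=> [|x /eqP x_neq0]; first exact/eqP/oner_neq0.
by exists x^-1; rewrite mulfV.
Qed.

Lemma field_like_inj (A B : comPzRingType) (f : {rmorphism A -> B}) :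
  field_like A -> 1 <> 0 :> B -> injective f.
Proof.
move=> [_ invA] one_neq0 x y /eqP; rewrite -subr_eq0 -rmorphB => /eqP fxy0.
apply/eqP; rewrite -subr_eq0; apply/negP => /negP /eqP /invA [z xyz].
by apply: one_neq0; rewrite -(rmorph1 f) -xyz rmorphM fxy0 mul0r.
Qed.

Lemma prime_ideal_field_like (A : comPzRingType) (P : A -> Prop) :
  field_like A -> prime_ideal P -> forall x, P x <-> x = 0.
Proof.
move=> [_ invA] [[_ P0 _ PM] [P1 _]] x; split=> [Px | -> //].
apply/eqP/negP => /negP /eqP /invA [y xy].
by apply: P1; rewrite -xy mulrC; apply: PM.
Qed.

Lemma prime_ideal_ker (A : comPzRingType) (K : fieldType)
    (f : {rmorphism A -> K}) : prime_ideal (fun x => f x = 0).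
Proof.
split; split=> //.
- exact: rmorph0.
- by move=> x y fx fy; rewrite rmorphD fx fy addr0.
- by move=> x y _ fy; rewrite rmorphM fy mulr0.
- by rewrite rmorph1; apply/eqP/oner_neq0.
move=> x y _ _ /eqP; rewrite rmorphM mulf_eq0 => /orP[] /eqP; tauto.
Qed.

Lemma prime_ideal0 (A : comPzRingType) :
  field_like A -> prime_ideal (fun x : A => x = 0).
Proof.
move=> [one_neq0 invA]; split; split=> //.
- by move=> x y -> ->; rewrite addr0.
- by move=> x y _ ->; rewrite mulr0.
move=> x y _ _ xy0; case: (x =P 0) => [|/invA [z xz]]; first by left.
by right; rewrite -[y]mulr1 -xz mulrA [y * x]mulrC xy0 mul0r.
Qed.

(** Each spectrum consists of the zero ideal alone, and injectivity of [f] matches the two. *)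
Lemma spec_surjective_field_like (A B : comPzRingType)
    (f : {rmorphism A -> B}) :
  field_like A -> field_like B -> spec_surjective f.
Proof.
move=> fA fB P primeP; exists (fun y => y = 0); first exact: prime_ideal0.
move=> x; rewrite (prime_ideal_field_like fA primeP).
split=> [->|]; first exact: rmorph0.
by rewrite -(rmorph0 f); apply: field_like_inj => //; case: fB.
Qed.

(* A product of fields with a surjection onto its spectrum from that of a     *)
(* field has exactly one prime ideal, hence exactly one factor.               *)
Lemma C0_field_like (E L : fieldType) (G : correspondence E)
    (w : {rmorphism corr_ring G -> L}) :
  in_C0 G -> spec_surjective w -> field_like (corr_ring G).
Proof.
move=> [[n [K [h [h_bij _]]]] _] w_surj.
(* The kernel of each projection is prime, hence the contraction of a prime of [L], which is zero:
   all projections have the kernel of [w]. *)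
have kerE i a : h i a = 0 <-> w a = 0.
  have [Q primeQ QE] := w_surj _ (prime_ideal_ker (h i)).
  by rewrite QE (prime_ideal_field_like (field_field_like L) primeQ).
have h_inj a b : (forall i, h i a = h i b) -> a = b.
  move=> hab; have [c [_ c_uniq]] := h_bij (h^~ b).
  by rewrite -(c_uniq a) // -(c_uniq b).
have one_neq0 : 1 <> 0 :> corr_ring G.
  by move/(congr1 w)/eqP; rewrite rmorph1 rmorph0 oner_eq0.
split=> // x x_neq0.
have hx i : h i x != 0.
  apply/eqP=> hix; apply: x_neq0; apply: h_inj => j.
  by rewrite rmorph0; apply/kerE/(kerE i).
have [y [hy _]] := h_bij (fun i => (h i x)^-1).
exists y; apply: h_inj => i; rewrite rmorphM rmorph1 hy mulfV //; exact: hx.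
Qed.

(** * Subfields as predicates *)

Definition is_subfield (K : fieldType) (S : K -> Prop) : Prop :=
  [/\ S 1,
      forall x y, S x -> S y -> S (x - y),
      forall x y, S x -> S y -> S (x * y) &
      forall x, S x -> S x^-1].

Lemma subfield_image (A : comPzRingType) (K L : fieldType)
    (w : {rmorphism A -> L}) (r : {rmorphism K -> L}) :
  field_like A -> is_subfield (fun y => exists x, w x = r y).
Proof.
move=> [_ invA]; split=> [|a b [x wx] [y wy]|a b [x wx] [y wy]|z [x wx]].
- by exists 1; rewrite !rmorph1.
- by exists (x - y); rewrite !rmorphB wx wy.
- by exists (x * y); rewrite !rmorphM wx wy.
(* Zero is its own inverse by convention. *)
have [x0|/invA [y xy]] := x =P 0.
  by exists 0; rewrite fmorphV -wx x0 !rmorph0 invr0.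
exists y; rewrite fmorphV -wx; apply: (mulfI (x := w x)).
  apply/eqP=> wx0; move/(congr1 w)/eqP: xy.
  by rewrite rmorphM wx0 mul0r rmorph1 eq_sym oner_eq0.
rewrite -rmorphM xy rmorph1 mulfV //; apply/eqP=> wx0.
move/(congr1 w)/eqP: xy.
by rewrite rmorphM wx0 mul0r rmorph1 eq_sym oner_eq0.
Qed.

Section Subfield.
Variables (K : fieldType) (S : K -> Prop).
Hypothesis subS : is_subfield S.

Lemma subfield1 : S 1. Proof. by case: subS. Qed.
Lemma subfieldB x y : S x -> S y -> S (x - y).
Proof. by case: subS => _ SB _ _; apply: SB. Qed.
Lemma subfieldM x y : S x -> S y -> S (x * y).
Proof. by case: subS => _ _ SM _; apply: SM. Qed.
Lemma subfieldV x : S x -> S x^-1.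
Proof. by case: subS => _ _ _; apply. Qed.
Lemma subfield0 : S 0.
Proof. by rewrite -(subrr 1); apply: subfieldB; apply: subfield1. Qed.
Lemma subfieldN x : S x -> S (- x).
Proof. by rewrite -sub0r; apply: subfieldB; apply: subfield0. Qed.
Lemma subfieldD x y : S x -> S y -> S (x + y).
Proof. by move=> Sx Sy; rewrite -[y]opprK; apply/subfieldB/subfieldN. Qed.
Lemma subfieldX x n : S x -> S (x ^+ n).
Proof.
move=> Sx; elim: n => [|n IHn]; first exact: subfield1.
by rewrite exprS; apply: subfieldM.
Qed.

Lemma subfield_horner (R : nzRingType) (a : {rmorphism R -> K}) (x : K)
    (q : {poly R}) :
  (forall c, S (a c)) -> S x -> S (map_poly a q).[x].
Proof.
move=> Sa Sx; elim/poly_ind: q => [|q c IHq].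
  by rewrite rmorph0 horner0; apply: subfield0.
rewrite rmorphD rmorphM /= map_polyX map_polyC !hornerE.
by apply: subfieldD (Sa c); apply: subfieldM.
Qed.

End Subfield.

(** * Composita: categorical reducedness and uniqueness of reductions *)

Section Reduction.
Variables (K Y : fieldType) (pi phi : {rmorphism K -> Y}).
Hypotheses (pi_fin : finite_rmorphism pi) (phi_fin : finite_rmorphism phi).
Hypothesis compositum : forall S : Y -> Prop, is_subfield S ->
  (forall x, S (pi x)) -> (forall x, S (phi x)) -> forall y, S y.

Let Gamma : correspondence K := @Correspondence K Y pi phi.

Lemma field_in_C0 : in_C0 Gamma.
Proof.
split=> //; exists 1%N, (fun=> Y), (fun=> idfun); split=> // k.
by exists (k 0); split=> [i|a ha]; [rewrite ord1 | rewrite -(ha 0)].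
Qed.

Lemma compositum_sub_image (A : comPzRingType) (L : fieldType)
    (w : {rmorphism A -> L}) (j : {rmorphism Y -> L}) :
  field_like A -> (forall x, exists a, w a = j (pi x)) ->
  (forall x, exists a, w a = j (phi x)) -> forall y, exists a, w a == j y.
Proof.
move=> fA wpi wphi y.
suff [a wa] : exists a, w a = j y by exists a; apply/eqP.
by apply: (compositum (S := fun y => exists a, w a = j y));
  first exact: subfield_image.
Qed.

(** The target of a morphism out of [Gamma] is a field embedded in [Y] whose image contains both
    copies of [K], hence all of [Y]; factoring the identity of [Y] gives the inverse. *)
Lemma compositum_categorically_reduced : categorically_reduced Gamma.
Proof.
split=> [|G v G_C0 [[v_pi v_phi] v_surj]]; first exact: field_in_C0.
have fG : field_like (corr_ring G).
  exact: (C0_field_like (L := Y) (w := v)).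
have fY := field_field_like Y.
have v_inj : injective v by apply: field_like_inj => //; case: fY.
have v_im : forall y, exists a, v a == (idfun : {rmorphism Y -> Y}) y.
  apply: compositum_sub_image => // x.
  - by exists (corr_pi G x).
  - by exists (corr_phi G x).
have [w wK] := rmorph_factor v_inj v_im.
split; first by split.
exists w; split.
- split; last exact: spec_surjective_field_like.
  by split=> x; apply: v_inj; rewrite wK ?v_pi ?v_phi.
- by move=> x; apply: v_inj; rewrite wK.
- exact: wK.
Qed.

Variables (E L : fieldType) (u : {rmorphism K -> E}) (i f : {rmorphism E -> L}).
Variable j : {rmorphism Y -> L}.
Hypotheses (j_pi : forall x, j (pi x) = i (u x)).
Hypotheses (j_phi : forall x, j (phi x) = f (u x)).

Let Gamma' : correspondence E := @Correspondence E L i f.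

Lemma compositum_reduction : reduction u (G' := Gamma') (G := Gamma) j.
Proof.
split; first exact: compositum_categorically_reduced.
  by split.
exact: spec_surjective_field_like (field_field_like Y) (field_field_like L).
Qed.

(** The ring of [G] embeds in [L] with image containing that of [Y], which yields a morphism from
    [G] to [Gamma]; it is an isomorphism because [G] itself is categorically reduced. *)
Lemma reduction_unique (G : correspondence K)
    (w : {rmorphism corr_ring G -> L}) :
  reduction u (G' := Gamma') w ->
  exists2 s : {rmorphism corr_ring G -> Y},
    @C0_iso K Gamma G s & forall x, j (s x) = w x.
Proof.
move=> [[G_C0 G_red] [w_pi w_phi] w_surj].
have fG := C0_field_like G_C0 w_surj; have fY := field_field_like Y.
have w_inj : injective w.
  by apply: field_like_inj => //; case: (field_field_like L).
have w_im : forall y, exists a, w a == j y.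
  apply: compositum_sub_image => // x.
  - by exists (corr_pi G x); rewrite w_pi j_pi.
  - by exists (corr_phi G x); rewrite w_phi j_phi.
have [r wr] := rmorph_factor w_inj w_im.
have r_mor : @C0_mor K G Gamma r.
  split; last exact: spec_surjective_field_like.
  split=> x; apply: w_inj; rewrite wr.
  - by rewrite w_pi j_pi.
  - by rewrite w_phi j_phi.
have [_ [s [s_mor rK sK]]] := G_red Gamma r field_in_C0 r_mor.
exists s; last by move=> x; rewrite -wr sK.
by split=> //; exists r.
Qed.

End Reduction.

(** * Adjoining one algebraic element *)

Lemma exists_adjoin (K L : fieldType) (a : {rmorphism K -> L}) (z : L)
    (q : {poly K}) :
  q != 0 -> root (map_poly a q) z ->
  exists (Y : fieldType) (b : {rmorphism K -> Y}) (j : {rmorphism Y -> L})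
         (y : Y),
    [/\ forall x, j (b x) = a x, j y = z &
        forall x, exists r, x = (map_poly b r).[y]].
Proof.
move=> q_neq0 qz.
exists (subFExtend a z q), (inj_subfx a z q), (@subfx_inj _ _ a z q).
exists (subfx_root a z q); split=> [x||x].
- by rewrite /inj_subfx /= subfx_inj_eval // map_polyC hornerC.
- exact: subfx_inj_root.
have [r ->] := subfxE x; exists r.
apply: (fmorph_inj (@subfx_inj _ _ a z q)).
apply: (etrans (subfx_inj_eval qz q_neq0 r)); rewrite -horner_map.
congr (_.[_]); last exact/esym/subfx_inj_root.
rewrite -map_poly_comp; apply: eq_map_poly => c.
apply: esym; apply: (etrans (subfx_inj_eval qz q_neq0 _)).
by rewrite map_polyC hornerC.
Qed.

Lemma finite_adjoin (K Y : fieldType) (b : {rmorphism K -> Y}) (y : Y)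
    (q : {poly K}) :
  q != 0 -> root (map_poly b q) y ->
  (forall x, exists r, x = (map_poly b r).[y]) -> finite_rmorphism b.
Proof.
move=> q_neq0 /rootP qy gen.
(* Division by [q] leaves a remainder of size below [size q]; the list has one power more than
   needed, with coefficient zero. *)
exists (size q), (fun k => y ^+ k) => x; have [r ->] := gen x.
exists (fun k => (r %% q)`_k); rewrite {1}(divp_eq r q) rmorphD rmorphM /=.
rewrite hornerD hornerM qy mulr0 add0r (horner_coef_wide (n := size q)).
  by apply: eq_bigr => k _; rewrite coef_map.
by rewrite size_map_poly ltnW // ltn_modp.
Qed.

(* The field Y' = K[y'] constructed by adjunction maps onto Y = K(y).         *)
Lemma finite_generated (K Y : fieldType) (b : {rmorphism K -> Y}) (y : Y)
    (q : {poly K}) :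
  q != 0 -> root (map_poly b q) y ->
  (forall S : Y -> Prop, is_subfield S -> (forall x, S (b x)) -> S y ->
    forall x, S x) ->
  finite_rmorphism b.
Proof.
move=> q_neq0 qy gen.
have [Y' [b' [j [y' [jb jy gen']]]]] := exists_adjoin q_neq0 qy.
apply: (finite_adjoin q_neq0 qy) => x.
have [x' <-] : exists x', j x' = x.
  apply: (gen (fun x => exists x', j x' = x)).
  - apply: (subfield_image _ (idfun : {rmorphism Y -> Y})).
    exact: field_field_like.
  - by move=> c; exists (b' c).
  - by exists y'.
have [r ->] := gen' x'; exists r; rewrite -horner_map jy; congr (_.[_]).
by rewrite -map_poly_comp; apply: eq_map_poly.
Qed.

(** * Rational functions and the fractional linear relation *)

Lemma fraction_div (R : idomainType) (x : {fraction R}) :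
  exists n d, x = FracField.tofrac n / FracField.tofrac d.
Proof.
elim/quotW: x => x; exists (frac x).1, (frac x).2.
(* Product and inverse are exposed as operations on representatives, which reduces the claim to
   cross-multiplication. *)
change (\pi_({fraction R})%qT x =
  FracField.mul (FracField.tofrac (frac x).1)
    (FracField.inv (FracField.tofrac (frac x).2))).
rewrite !piE; apply/eqmodP; rewrite /= FracField.equivfE.
rewrite /FracField.mulf /FracField.invf.
rewrite !numden_Ratio ?mulf_neq0 ?oner_eq0 ?denom_ratioP //.
by rewrite mulr1 mul1r mulrC.
Qed.

(** The hypothesis is a fractional linear relation with denominator cleared; collecting the terms in
    [v] inverts it. *)
Lemma mobius_solve (A : comPzRingType) (e s T v : A) :
  s * (e * T * v + 1 + v) = T * (1 + v) - e * v ->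
  (e * s * T + s - T + e) * v = T - s.
Proof.
move=> s_eq; apply/eqP; rewrite -subr_eq0.
have -> : (e * s * T + s - T + e) * v - (T - s) =
  s * (e * T * v + 1 + v) - (T * (1 + v) - e * v) by ring.
by rewrite s_eq subrr.
Qed.

(* With N = T - s and v = N / D, one has                                      *)
(* D^2 (2 v^2 + 2 v + 1) = N^2 + (N + D)^2 = (T^2 + 1) (s^2 + 1).             *)
Lemma mobius_norm (A : comPzRingType) (e s T v : A) :
  e ^+ 2 = 1 -> s * (e * T * v + 1 + v) = T * (1 + v) - e * v ->
  (2 * v ^+ 2 + 2 * v + 1) * (e * s * T + s - T + e) ^+ 2 =
  (T ^+ 2 + 1) * (s ^+ 2 + 1).
Proof.
move=> e2 /mobius_solve; set D := (X in X * v) => Dv.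
have -> : (2 * v ^+ 2 + 2 * v + 1) * D ^+ 2 =
  2 * (D * v) ^+ 2 + 2 * (D * v) * D + D ^+ 2 by ring.
rewrite Dv.
have -> : 2 * (T - s) ^+ 2 + 2 * (T - s) * D + D ^+ 2 =
  (T - s) ^+ 2 + e ^+ 2 * (s * T + 1) ^+ 2 by rewrite /D; ring.
by rewrite e2; ring.
Qed.

Lemma horner_map_twist (R S : comNzRingType) (h : {rmorphism R -> S}) (t : S)
    (p : nat) (A B C E : R) :
  (map_poly h (A%:P * ('X^(2 * p) + 1) ^+ 2
   - B%:P * ('X^2 + 1) ^+ p * (C%:P * 'X^p + E%:P) ^+ 2)).[t] =
  h A * (t ^+ (2 * p) + 1) ^+ 2
  - h B * (t ^+ 2 + 1) ^+ p * (h C * t ^+ p + h E) ^+ 2.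
Proof.
rewrite rmorphB !rmorphM !rmorphXn !rmorphD !rmorphM !rmorph1 !rmorphXn /=.
rewrite !map_polyC !map_polyX hornerD hornerN !hornerM !hornerC.
rewrite !horner_exp !hornerD !hornerM !hornerC !hornerXn ?hornerX.
by [].
Qed.

Section RationalFunctions.
Variable F : fieldType.

Local Notation K := {fraction {poly F}}.
Local Notation cst c := (FracField.tofrac (c%:P : {poly F}) : K).
Local Notation x_ := (FracField.tofrac ('X : {poly F}) : K).

Lemma ratfun_subfield (L : fieldType) (g : {rmorphism K -> L})
    (S : L -> Prop) :
  is_subfield S -> (forall c, S (g (cst c))) -> S (g x_) -> forall x, S (g x).
Proof.
move=> subS Sc SX x; have [n [d ->]] := fraction_div x.
have Sp q : S (g (FracField.tofrac q)).
  elim/poly_ind: q => [|q c IHq]; first by rewrite !rmorph0; apply: subfield0.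
  rewrite !rmorphD !rmorphM /=.
  by apply: (subfieldD subS _ (Sc c)); apply: subfieldM.
by rewrite rmorphM fmorphV; apply: subfieldM => //; apply: subfieldV.
Qed.

Section Twist.
Variables (L : fieldType) (a g : {rmorphism K -> L}).
Variables (b : bool) (p : nat) (v : L) (d k : F).

Let t : L := a x_.
Let s : L := g x_.
Let e : L := (-1) ^+ b.

Hypothesis two_neq0 : 2 != 0 :> F.
Hypothesis k_neq0 : k != 0.
Hypothesis p_gt0 : (0 < p)%N.
Hypothesis s_eq : s * (e * t ^+ p * v + 1 + v) = t ^+ p * (1 + v) - e * v.
Hypothesis v_eq : g (cst d) * (t ^+ (2 * p) + 1) * (2 * v ^+ 2 + 2 * v + 1) =
  g (cst k) * (t ^+ 2 + 1) ^+ p.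

Let D : L := e * s * t ^+ p + s - t ^+ p + e.

Lemma twist_denomM : D * v = t ^+ p - s.
Proof.
exact: mobius_solve s_eq.
Qed.

(** If D vanished, then t^p = s and D = e (s^2 + 1); but s is the image of the indeterminate under
    an injective map, so s^2 + 1 is nonzero. *)
Lemma twist_denom_neq0 : D != 0.
Proof.
apply/eqP=> D0; move: twist_denomM; rewrite D0 mul0r => /esym /eqP.
rewrite subr_eq0 => /eqP Ts; move: D0; rewrite /D Ts.
have -> : e * s * s + s - s + e = e * (s ^+ 2 + 1) by ring.
move/eqP; rewrite mulf_eq0 signr_eq0 /= => /eqP s0.
have : g (FracField.tofrac ('X^2 + 1)) = 0.
  by rewrite !rmorphD !rmorphXn !rmorph1.
move/eqP; rewrite fmorph_eq0 tofrac_eq0 -size_poly_eq0.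
by rewrite size_polyDl size_polyXn ?size_poly1.
Qed.

Lemma twist_root : v = (t ^+ p - s) / D.
Proof. by rewrite -twist_denomM mulrAC mulfV ?mul1r ?twist_denom_neq0. Qed.

(* The relation v_eq with v = (t^p - s) / D and denominators cleared, as a    *)
(* polynomial in t whose coefficients are polynomials in s.                   *)
Definition twist_poly : {poly {poly F}} :=
  (d%:P * ('X^2 + 1))%:P * ('X^(2 * p) + 1) ^+ 2
  - k%:P%:P * ('X^2 + 1) ^+ p *
    (((-1) ^+ b * 'X - 1)%:P * 'X^p + ('X + (-1) ^+ b)%:P) ^+ 2.

(** As p > 0, the value at t = 0 is d (X^2 + 1) - k (X + e)^2, whose values at X = 1 and X = -1
    differ by 4 k up to sign. *)
Lemma twist_poly_neq0 : twist_poly != 0.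
Proof.
have horner0E (A B C E : {poly F}) :
    (A%:P * ('X^(2 * p) + 1) ^+ 2
     - B%:P * ('X^2 + 1) ^+ p * (C%:P * 'X^p + E%:P) ^+ 2).[0] =
    A - B * E ^+ 2.
  rewrite hornerD hornerN !hornerM !hornerC !horner_exp !hornerD !hornerM.
  rewrite !hornerC !hornerXn !expr0n muln_eq0 !gtn_eqF //=.
  by rewrite hornerX !mulr0 !add0r expr1n !mulr1.
have tp0 := horner0E _ _ _ _ : twist_poly.[0] =
  d%:P * ('X^2 + 1) - k%:P * ('X + (-1) ^+ b) ^+ 2.
apply/eqP=> tw0; move: tp0; rewrite tw0 horner0.
set P := (X in 0 = X) => P0.
have : P.[1] - P.[-1] = - (2 * 2 * k * (-1) ^+ b).
  rewrite /P -(rmorph_sign (@polyC F)); move: ((-1) ^+ b : F) => c.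
  rewrite !(hornerD, hornerN, hornerM, hornerXn, hornerX, hornerC). ring.
rewrite -P0 !horner0 subrr => /esym /eqP.
by rewrite oppr_eq0 !mulf_eq0 signr_eq0 (negPf two_neq0) (negPf k_neq0).
Qed.

(** Multiply [v_eq] by D^2 and apply [mobius_norm] with T = t^p; the squared factor in the second
    term of the polynomial is D, ordered by powers of t^p. *)
Lemma twist_poly_root :
  root (map_poly (g \o @FracField.tofrac {poly F}) twist_poly) t.
Proof.
pose h := g \o @FracField.tofrac {poly F} : {rmorphism {poly F} -> L}.
(* Zero is written as the right side of [v_eq] times D^2, minus itself; the first copy is then
   rewritten by [v_eq]. *)
apply/rootP; rewrite -[RHS](subrr (h k%:P * (t ^+ 2 + 1) ^+ p * D ^+ 2)).
rewrite -{1}v_eq -(mulrA (_ * _)) mulnC exprM mobius_norm ?sqrr_sign //.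
rewrite -exprM mulnC.
apply: (etrans (horner_map_twist h _ _ _ _ _ _)).
have hX : h 'X = s by [].
have hdX : h (d%:P * ('X^2 + 1)) = h d%:P * (s ^+ 2 + 1).
  by rewrite rmorphM rmorphD rmorphXn rmorph1 hX.
have heX : h ((-1) ^+ b * 'X - 1) = e * s - 1.
  by rewrite rmorphB rmorphM rmorph_sign rmorph1 hX.
have hXe : h ('X + (-1) ^+ b) = s + e by rewrite rmorphD rmorph_sign hX.
rewrite hdX heX hXe.
have alg (x y T2 Q T z r : L) :
    x * (z ^+ 2 + 1) * (T2 + 1) ^+ 2 - y * Q * ((r * z - 1) * T + (z + r)) ^+ 2
    = x * (T2 + 1) * ((T2 + 1) * (z ^+ 2 + 1))
      - y * Q * (r * z * T + z - T + r) ^+ 2.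
  by ring.
exact: alg.
Qed.

End Twist.
End RationalFunctions.

(** * The reduction attached to one twist *)

Section TwistReduction.
Variables (F L Y E : fieldType).

Local Notation K := {fraction {poly F}}.
Local Notation cst c := (FracField.tofrac (c%:P : {poly F}) : K).
Local Notation x_ := (FracField.tofrac ('X : {poly F}) : K).

Variables (u : {rmorphism K -> E}) (i f : {rmorphism E -> L}).
Variables (pi : {rmorphism K -> Y}) (j : {rmorphism Y -> L}) (y : Y).
Variables (b : bool) (p : nat) (d k : F) (tau tau' : F -> F).

Let t : L := i (u x_).
Let v : L := j y.
Let e : L := (-1) ^+ b.

Hypothesis two_neq0 : 2 != 0 :> F.
Hypothesis k_neq0 : k != 0.
Hypothesis p_gt0 : (0 < p)%N.
Hypothesis pi_fin : finite_rmorphism pi.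
Hypothesis pi_gen : forall x, exists r, x = (map_poly pi r).[y].
Hypothesis j_pi : forall x, j (pi x) = i (u x).
Hypothesis tau'K : cancel tau' tau.
Hypothesis f_cst : forall c, f (u (cst c)) = i (u (cst (tau c))).
Hypothesis denom_neq0 : e * t ^+ p * v + 1 + v != 0.
Hypothesis f_x :
  f (u x_) = (t ^+ p * (1 + v) - e * v) / (e * t ^+ p * v + 1 + v).
Hypothesis v_eq :
  f (u (cst d)) * (t ^+ (2 * p) + 1) * (2 * v ^+ 2 + 2 * v + 1) =
  f (u (cst k)) * (t ^+ 2 + 1) ^+ p.

(** The map [phi] is [f] on F(t) with its values taken in [Y]. The relations between s, t and v
    descend to [Y] as [j] is injective, and there give generation and finiteness. *)
Lemma twist_reduction :
  exists phi : {rmorphism K -> Y},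
    reduction u (G' := @Correspondence E L i f)
      (G := @Correspondence K Y pi phi) j /\
    forall (G : correspondence K) (w : {rmorphism corr_ring G -> L}),
      reduction u (G' := @Correspondence E L i f) w ->
      exists2 s : {rmorphism corr_ring G -> Y},
        @C0_iso K (@Correspondence K Y pi phi) G s & forall x, j (s x) = w x.
Proof.
have j_inj := fmorph_inj j.
have j_t : j (pi x_) = t by rewrite j_pi.
have f_im x : exists a, j a == (f \o u : {rmorphism K -> L}) x.
  suff [a ja] : exists a, j a = f (u x) by exists a; apply/eqP.
  apply: (ratfun_subfield (g := f \o u) (S := fun z => exists a, j a = z)).
  - apply: (subfield_image _ (idfun : {rmorphism L -> L})).
    exact: field_field_like.
  - by move=> c; exists (pi (cst (tau c))); rewrite j_pi -f_cst.
  - exists ((pi x_ ^+ p * (1 + y) - (-1) ^+ b * y) /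
             ((-1) ^+ b * pi x_ ^+ p * y + 1 + y)).
    rewrite fmorph_div !(rmorphB, rmorphD, rmorphM, rmorphXn, rmorph1).
    by rewrite rmorphN1 j_t -f_x.
have [phi j_phi] := rmorph_factor j_inj f_im.
have s_eqY : phi x_ * ((-1) ^+ b * pi x_ ^+ p * y + 1 + y) =
    pi x_ ^+ p * (1 + y) - (-1) ^+ b * y.
  apply: j_inj; rewrite !(rmorphB, rmorphD, rmorphM, rmorphXn, rmorph1).
  by rewrite rmorphN1 j_t j_phi /= f_x divfK.
have v_eqY : phi (cst d) * (pi x_ ^+ (2 * p) + 1) * (2 * y ^+ 2 + 2 * y + 1) =
    phi (cst k) * (pi x_ ^+ 2 + 1) ^+ p.
  apply: j_inj; rewrite !(rmorphB, rmorphD, rmorphM, rmorphXn, rmorph1).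
  by rewrite j_t !j_phi.
(* By [twist_root], [y] is a rational expression in the two images of the indeterminate. *)
have y_gen (S : Y -> Prop) : is_subfield S -> (forall x, S (pi x)) ->
    (forall x, S (phi x)) -> forall x, S x.
  move=> subS Spi Sphi x; have [r ->] := pi_gen x.
  apply: subfield_horner => //; rewrite (twist_root s_eqY).
  have Se : S ((-1) ^+ b).
    by apply: subfieldX => //; apply: subfieldN => //; apply: subfield1.
  have ST : S (pi x_ ^+ p) by apply: subfieldX (Spi x_).
  have Ss := Sphi x_.
  apply: subfieldM => //; first exact: subfieldB.
  apply: subfieldV => //; apply: subfieldD => //; apply: subfieldB => //.
  by apply: subfieldD => //; do 2?apply: subfieldM.
(* Over the image of [phi], [Y] is generated by [pi x_] alone: both images contain the same
   constants, since [tau] is onto. *)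
have phi_fin : finite_rmorphism phi.
  apply: (finite_generated (y := pi x_)
    (q := map_poly (@FracField.tofrac {poly F}) (twist_poly b p d k))).
  - rewrite map_poly_eq0_id0 ?twist_poly_neq0 //.
    by rewrite tofrac_eq0 lead_coef_eq0 twist_poly_neq0.
  - rewrite -map_poly_comp.
    exact: twist_poly_root s_eqY v_eqY.
  move=> S subS Sphi Sx; apply: y_gen => // x.
  apply: ratfun_subfield => // c.
  suff -> : pi (cst c) = phi (cst (tau' c)) by [].
  by apply: j_inj; rewrite j_phi /= f_cst tau'K j_pi.
exists phi; split; first exact: compositum_reduction.
by move=> G w; apply: reduction_unique.
Qed.

End TwistReduction.

(** * Adjoining a root of the quadratic *)

Lemma horner_map_quadratic (R S : comNzRingType) (h : {rmorphism R -> S})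
    (z : S) :
  (map_poly h (2%:P * 'X^2 + 2%:P * 'X + 1)).[z] = 2 * z ^+ 2 + 2 * z + 1.
Proof.
rewrite 2!rmorphD !rmorphM rmorph1 /= !map_polyC !map_polyX.
rewrite 2!hornerD !hornerM !hornerC hornerX.
by rewrite /= (rmorph_nat h).
Qed.

Lemma horner_map_scaled_quadratic (R S : comNzRingType)
    (h : {rmorphism R -> S}) (c c' : R) (z : S) :
  (map_poly h (c%:P * (2%:P * 'X^2 + 2%:P * 'X + 1) - c'%:P)).[z] =
  h c * (2 * z ^+ 2 + 2 * z + 1) - h c'.
Proof.
rewrite rmorphB (rmorphM _ c%:P) /= hornerD hornerN hornerM.
by rewrite horner_map_quadratic !map_polyC !hornerC.
Qed.

(** The values at 1 and 0 differ by 4 c. *)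
Lemma scaled_quadratic_neq0 (K : fieldType) (c c' : K) :
  2 != 0 :> K -> c != 0 ->
  c%:P * (2%:P * 'X^2 + 2%:P * 'X + 1) - c'%:P != 0.
Proof.
move=> two_neq0 c_neq0; apply/eqP=> q0.
have q0E := horner_map_scaled_quadratic (idfun : {rmorphism K -> K}) c c'.
have : 2 * 2 * c = 0.
  transitivity ((c * (2 * 1 ^+ 2 + 2 * 1 + 1) - c') -
    (c * (2 * 0 ^+ 2 + 2 * 0 + 1) - c')); first by ring.
  by rewrite -[X in X - _]q0E -[X in _ - X]q0E q0 rmorph0 !horner0 subrr.
by move/eqP; rewrite !mulf_eq0 (negPf two_neq0) (negPf c_neq0).
Qed.

(** The field is K(v), of degree at most 2; the relation for [v] is pulled back along the injective
    [j] to one for [y]. *)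
Lemma quadratic_adjoin (K L : fieldType) (a : {rmorphism K -> L}) (c c' : K)
    (v : L) :
  2 != 0 :> K -> c != 0 -> a c * (2 * v ^+ 2 + 2 * v + 1) = a c' ->
  exists (Y : fieldType) (pi : {rmorphism K -> Y}) (j : {rmorphism Y -> L})
         (y : Y),
    [/\ finite_rmorphism pi, forall x, j (pi x) = a x, j y = v &
        forall x, exists r, x = (map_poly pi r).[y]].
Proof.
move=> two_neq0 c_neq0 v_eq.
have q_neq0 := scaled_quadratic_neq0 c' two_neq0 c_neq0.
have qv : root (map_poly a
    (c%:P * (2%:P * 'X^2 + 2%:P * 'X + 1) - c'%:P)) v.
  by apply/rootP; rewrite horner_map_scaled_quadratic v_eq subrr.
have [Y [pi [j [y [j_pi jy gen]]]]] := exists_adjoin q_neq0 qv.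
exists Y, pi, j, y; split=> //.
apply: (finite_adjoin (y := y) q_neq0) => //.
apply/rootP/(fmorph_inj j); rewrite rmorph0 -(rootP qv) -horner_map jy.
by rewrite -map_poly_comp; congr (_.[_]); apply: eq_map_poly.
Qed.

(** * Homogeneity of theta and the two rotations *)

Lemma mul_div_cancel (K : fieldType) (C X B P Q : K) :
  C != 0 -> X != 0 -> B != 0 -> C * X * (P * (B * Q) / (C * (B * X))) = P * Q.
Proof. by move=> C0 X0 B0; field; rewrite C0 X0 B0. Qed.

Section QuadraticTwist.
Variables (F E L : fieldType).

Local Notation K := {fraction {poly F}}.
Local Notation cst c := (FracField.tofrac (c%:P : {poly F}) : K).
Local Notation x_ := (FracField.tofrac ('X : {poly F}) : K).

Variables (u : {rmorphism K -> E}) (i : {rmorphism E -> L}).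
Variables (cE : F -> E) (al be : E) (p : nat) (d : F) (v : L).
Variables (tau : {rmorphism F -> F}) (tau' : F -> F).

Let th : E := (cE d ^+ p * (al ^+ 2 + be ^+ 2) ^+ p) /
  (cE (tau d) * (al ^+ (2 * p) + be ^+ (2 * p))).

Hypothesis two_neq0 : 2 != 0 :> F.
Hypothesis d_neq0 : d != 0.
Hypothesis p_gt0 : (0 < p)%N.
Hypothesis be_neq0 : be != 0.
Hypothesis tau'K : cancel tau' tau.
Hypothesis u_cst : forall c, u (cst c) = cE c.
Hypothesis u_x : u x_ = al / be.
Hypothesis v_root :
  root (map_poly i (2%:P * 'X^2 + 2%:P * 'X + 1 - th%:P)) v.

Let ratfun_neq0 : x_ ^+ (2 * p) + 1 != 0.
Proof.
rewrite -rmorphXn -(rmorph1 (@FracField.tofrac {poly F})) -rmorphD tofrac_eq0.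
by rewrite -size_poly_eq0 size_polyDl size_polyXn ?size_poly1 // ltnS muln_gt0.
Qed.

Let cst_neq0 c : c != 0 -> cE c != 0.
Proof. by rewrite -u_cst fmorph_eq0 tofrac_eq0 polyC_eq0. Qed.

(** Since al^n + be^n = be^n (t^n + 1), the powers of [be] cancel in [th], leaving d^p (t^2 + 1)^p /
    (tau(d) (t^(2p) + 1)), an element of F(t). *)
Lemma quadratic_root_eq :
  i (u (cst (tau d))) * (i (u x_) ^+ (2 * p) + 1) * (2 * v ^+ 2 + 2 * v + 1) =
  i (u (cst (d ^+ p))) * (i (u x_) ^+ 2 + 1) ^+ p.
Proof.
have -> : 2 * v ^+ 2 + 2 * v + 1 = i th.
  move/rootP: v_root; rewrite rmorphB hornerD hornerN /= map_polyC hornerC.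
  by rewrite horner_map_quadratic => /eqP; rewrite subr_eq0 => /eqP.
have X_neq0 : u x_ ^+ (2 * p) + 1 != 0.
  by rewrite -rmorphXn -(rmorph1 u) -rmorphD fmorph_eq0.
have C_neq0 : cE (tau d) != 0 by rewrite cst_neq0 ?fmorph_eq0.
have pow n : al ^+ n + be ^+ n = be ^+ n * (u x_ ^+ n + 1).
  by rewrite u_x mulrDr mulr1 -exprMn mulrCA mulfV ?mulr1.
have -> : u (cst (d ^+ p)) = cE d ^+ p by rewrite -u_cst !rmorphXn.
rewrite -(rmorph1 i) -!(rmorphXn i) -!(rmorphD i) -!(rmorphXn i) -!(rmorphM i).
congr (i _); rewrite u_cst /th !pow exprMn -exprM.
have B_neq0 : be ^+ (2 * p) != 0 by rewrite expf_neq0.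
exact: mul_div_cancel.
Qed.

(** Both [f al] and [f be] are be^p times an expression in t and v; the common factor cancels in the
    quotient, which is s. *)
Lemma quadratic_twist_reduction (b : bool) (Y : fieldType)
    (pi : {rmorphism K -> Y}) (j : {rmorphism Y -> L}) (y : Y)
    (f : {rmorphism E -> L}) :
  finite_rmorphism pi -> (forall x, j (pi x) = i (u x)) -> j y = v ->
  (forall x, exists r, x = (map_poly pi r).[y]) ->
  (forall c, f (cE c) = i (cE (tau c))) ->
  f al = i (al ^+ p) * (1 + v) - i (be ^+ p) * ((-1) ^+ b * v) ->
  f be = i (al ^+ p) * ((-1) ^+ b * v) + i (be ^+ p) * (1 + v) ->
  exists phi : {rmorphism K -> Y},
    reduction u (G' := @Correspondence E L i f)
      (G := @Correspondence K Y pi phi) j /\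
    forall (G : correspondence K) (w : {rmorphism corr_ring G -> L}),
      reduction u (G' := @Correspondence E L i f) w ->
      exists2 s : {rmorphism corr_ring G -> Y},
        @C0_iso K (@Correspondence K Y pi phi) G s & forall x, j (s x) = w x.
Proof.
move=> pi_fin j_pi jy gen f_cE f_al f_be.
have ibe_neq0 : i be ^+ p != 0 by rewrite expf_neq0 ?fmorph_eq0.
have i_al : i (al ^+ p) = i be ^+ p * i (u x_) ^+ p.
  by rewrite -exprMn -rmorphM u_x mulrCA mulfV // mulr1 rmorphXn.
have f_beE : f be =
    i be ^+ p * ((-1) ^+ b * i (u x_) ^+ p * v + 1 + v).
  by rewrite f_be i_al rmorphXn; ring.
have f_alE : f al =
    i be ^+ p * (i (u x_) ^+ p * (1 + v) - (-1) ^+ b * v).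
  by rewrite f_al i_al rmorphXn; ring.
have denom_neq0 : (-1) ^+ b * i (u x_) ^+ p * v + 1 + v != 0.
  have : f be != 0 by rewrite fmorph_eq0.
  by rewrite f_beE mulf_eq0 negb_or => /andP[].
(* With this [k], the map [f] sends the constants d and k to tau(d) and d^p, the coefficients in
   [quadratic_root_eq]. *)
apply: (twist_reduction (y := y) (b := b) (p := p) (d := d)
  (k := tau' (d ^+ p)) (tau := tau) (tau' := tau')) => //.
- apply/eqP=> /(congr1 tau); rewrite tau'K rmorph0 => /eqP.
  by rewrite expf_eq0 (negPf d_neq0) andbF.
- by move=> c; rewrite !u_cst.
- by rewrite jy.
- by rewrite jy {1}u_x fmorph_div f_alE f_beE -mulf_div mulfV // mul1r.
- by rewrite jy u_cst f_cE -u_cst quadratic_root_eq !u_cst f_cE tau'K.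
Qed.

(** The top row of the rotation identity, with [b] selecting v or -v. *)
Definition twisted_by (b : bool) (f : {rmorphism E -> L}) : Prop :=
  [/\ forall c, f (cE c) = i (cE (tau c)),
      f al = i (al ^+ p) * (1 + v) - i (be ^+ p) * ((-1) ^+ b * v) &
      f be = i (al ^+ p) * ((-1) ^+ b * v) + i (be ^+ p) * (1 + v)].

Lemma quadratic_twists (b1 b2 : bool) (f1 f2 : {rmorphism E -> L}) :
  twisted_by b1 f1 -> twisted_by b2 f2 ->
  let Gamma1 := @Correspondence E L i f1 in
  let Gamma2 := @Correspondence E L i f2 in
  exists (Y : comPzRingType) (pi phi1 phi2 : {rmorphism K -> Y}),
  let Gamma1''' := @Correspondence K Y pi phi1 in
  let Gamma2''' := @Correspondence K Y pi phi2 in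
  exists w1 w2 : {rmorphism Y -> L},
  [/\ @reduction K E u Gamma1 Gamma1''' w1,
      @reduction K E u Gamma2 Gamma2''' w2,
      forall (G : correspondence K) (w : {rmorphism corr_ring G -> L}),
        @reduction K E u Gamma1 G w ->
        exists2 s : {rmorphism corr_ring G -> Y},
          @C0_iso K Gamma1''' G s & forall x, w1 (s x) = w x &
      forall (G : correspondence K) (w : {rmorphism corr_ring G -> L}),
        @reduction K E u Gamma2 G w ->
        exists2 s : {rmorphism corr_ring G -> Y},
          @C0_iso K Gamma2''' G s & forall x, w2 (s x) = w x].
Proof.
move=> [f1_cE f1_al f1_be] [f2_cE f2_al f2_be].
(* The equation of v over F(t) does not involve [f1] or [f2], so one [Y] and one [j] serve both. *)
have [||| Y [pi [j [y [pi_fin j_pi jy gen]]]]] := quadratic_adjoin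
  (a := i \o u) (c := cst (tau d) * (x_ ^+ (2 * p) + 1))
  (c' := cst (d ^+ p) * (x_ ^+ 2 + 1) ^+ p) (v := v).
- rewrite -(rmorph_nat (@FracField.tofrac {poly F})) tofrac_eq0.
  by rewrite -polyC_natr polyC_eq0.
- apply: mulf_neq0; last exact: ratfun_neq0.
  by rewrite tofrac_eq0 polyC_eq0 fmorph_eq0.
- rewrite /= !(rmorphM u, rmorphXn u, rmorphD u, rmorph1 u).
  rewrite !(rmorphM i, rmorphXn i, rmorphD i, rmorph1 i).
  exact: quadratic_root_eq.
have [phi1 [red1 uniq1]] := quadratic_twist_reduction
  pi_fin j_pi jy gen f1_cE f1_al f1_be.
have [phi2 [red2 uniq2]] := quadratic_twist_reduction
  pi_fin j_pi jy gen f2_cE f2_al f2_be.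
by exists Y, pi, phi1, phi2, j, j; split.
Qed.

End QuadraticTwist.

(** * Specialization to the number field and its Frobenius element *)

Theorem proposition3p19 (F : splittingFieldType rat)
  (F_galois : galois 1%AS {:F}%AS)
  (D M : int) (discF : is_discriminant F D)
  (M_even : (2 %| M)%Z) (disc_M : (D %| M)%Z)
  (p : nat) (p_prime : prime p) (p_ndvd_M : ~~ (p %| M)%Z)
  (P : F -> Prop) (P_above : prime_lying_above M p P)
  (phi : gal_of {:F}%AS) (phi_frob : is_frobenius M p P phi)
  (sigma1 sigma2 : gal_of {:F}%AS)
  (sigma1_id : sigma1 = 1%g) (sigma2_gal : sigma2 \in 'Gal({:F} / 1)%g)
  (d : F) (d_unit : localized_units M d) (d_inv : sigma2 d = d)
  (u : {rmorphism Ft F -> Fab F}) (u_incl : Ft_inclusion u)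
  (L : fieldExtType (Fab F)) (v : L) (L_def : theta_extension p phi d v)
  (f1 f2 : {rmorphism Fab F -> L})
  (f1_def : gauged_frobenius p phi (rotation_mx (1 + v) v) f1)
  (f2_def : gauged_frobenius p phi (rotation_mx (1 + v) (- v)) f2) :
  let Gamma1 := @Correspondence (Fab F) L (in_alg L) f1 in
  let Gamma2 := @Correspondence (Fab F) L (in_alg L) f2 in
  exists (Y : comPzRingType) (pi phi1 phi2 : {rmorphism Ft F -> Y}),
  let Gamma1''' := @Correspondence (Ft F) Y pi phi1 in
  let Gamma2''' := @Correspondence (Ft F) Y pi phi2 in
  exists w1 w2 : {rmorphism Y -> L},
  [/\ @reduction (Ft F) (Fab F) u Gamma1 Gamma1''' w1,
      @reduction (Ft F) (Fab F) u Gamma2 Gamma2''' w2,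
      forall (G : correspondence (Ft F)) (w : {rmorphism corr_ring G -> L}),
        @reduction (Ft F) (Fab F) u Gamma1 G w ->
        exists2 s : {rmorphism corr_ring G -> Y},
          @C0_iso (Ft F) Gamma1''' G s & forall x, w1 (s x) = w x &
      forall (G : correspondence (Ft F)) (w : {rmorphism corr_ring G -> L}),
        @reduction (Ft F) (Fab F) u Gamma2 G w ->
        exists2 s : {rmorphism corr_ring G -> Y},
          @C0_iso (Ft F) Gamma2''' G s & forall x, w2 (s x) = w x].
Proof.
have p_gt0 := prime_gt0 p_prime.
have d_neq0 : d != 0 by case: d_unit.
have two_neq0 : 2 != 0 :> F.
  by rewrite -(rmorph_nat (in_alg F)) fmorph_eq0.
have be_neq0 : beta F != 0.
  rewrite /beta tofrac_eq0; apply/eqP=> /(congr1 (mcoeff U_(1))).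
  by rewrite mcoeffX eqxx mcoeff0 => /eqP; rewrite oner_eq0.
have phiVK : cancel (phi^-1%g : gal_of {:F}%AS) phi.
  by move=> x; rewrite -galM ?memvf // mulVg gal_id.
have [u_cst u_x] := u_incl.
have [v_root _] := L_def.
(* The sign (-1)^b treats both rotations at once; the entries (0, 0) and (0, 1) give the two
   formulas. *)
have twisted (f : {rmorphism Fab F -> L}) (b : bool) :
    gauged_frobenius p phi (rotation_mx (1 + v) ((-1) ^+ b * v)) f ->
    twisted_by (in_alg L) (@Fab_const F) (alpha F) (beta F) p v phi b f.
  move=> [f_cst f_mx]; split=> //.
  - move/matrixP/(_ 0 0): f_mx; rewrite !mxE !big_ord_recl big_ord0 !mxE /=.
    by rewrite addr0 mulrN.
  - move/matrixP/(_ 0 1): f_mx; rewrite !mxE !big_ord_recl big_ord0 !mxE /=.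
    by rewrite addr0.
apply: (quadratic_twists (tau := phi) (tau' := (phi^-1)%g) (b1 := false)
  (b2 := true) two_neq0 d_neq0 p_gt0 be_neq0 phiVK u_cst u_x v_root);
  apply: twisted.
- by rewrite expr0 mul1r.
- by rewrite expr1 mulN1r.
Qed.
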